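(* Let $G$ be a nontrivial connected graph and let $n\geq 5$ be an integer. If $n(n-1)\lambda'(G)>(n-1)\xi(G)+2(n-2)$, then the direct product $G\times K_n$ is super restricted edge-connected (super-$\lambda'$).
   Context: $G$ is a finite simple graph; it is nontrivial if it has at least two vertices. $K_n$ is the complete graph on $n$ vertices. For an edge $uv\in E(G)$ its edge-degree is $d_G(u)+d_G(v)-2$, and the minimum edge-degree is $\xi(G)=\min\{d_G(u)+d_G(v)-2: uv\in E(G)\}$. For a graph $H$, an edge subset $F\subseteq E(H)$ is an edge-cut if $H-F$ (delete the edges in $F$, keep all vertices) is disconnected. A restricted edge-cut of $H$ is an edge-cut $F$ such that every component of $H-F$ has at least two vertices (equivalently, $H-F$ is disconnected and has no isolated vertices). The restricted edge-connectivity $\lambda'(H)$ is the cardinality of a minimum (i.e. smallest-cardinality) restricted edge-cut of $H$ if $H$ has a restricted edge-cut, and $\lambda'(H)=+\infty$ otherwise (so an inequality $n(n-1)\lambda'(G)>c$ with finite $c$ holds when $\lambda'(G)=+\infty$). $H$ is super restricted edge-connected (super-$\lambda'$) if every minimum restricted edge-cut $F$ of $H$ isolates an edge from $H$, i.e. some component of $H-F$ consists of exactly two vertices joined by an edge. The direct product $G_1\times G_2$ has vertex set $V(G_1)\times V(G_2)$, with $(u_1,v_1)$ adjacent to $(u_2,v_2)$ if and only if $u_1u_2\in E(G_1)$ and $v_1v_2\in E(G_2)$. *)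

(* Defs.v *)
From mathcomp Require Import all_boot all_order all_algebra.
From mathcomp Require Import constructive_ereal.

Set Implicit Arguments.
Unset Strict Implicit.
Unset Printing Implicit Defensive.

Record sgraph := SGraph {
  vertex :> finType;
  adj : rel vertex;
  adj_sym : symmetric adj;
  adj_irrefl : irreflexive adj }.

Arguments adj {s} _ _.

Section Graph.
Variable G : sgraph.
Implicit Types (u v : G) (F : {set {set G}}).

Definition edges : {set {set G}} := [set [set p.1; p.2] | p : G * G & adj p.1 p.2].

Definition deg u : nat := #|[set v | adj u v]|.

Definition connected : bool := [forall u, forall v, connect (@adj G) u v].

Definition components : {set {set G}} :=
  [set [set v | connect (@adj G) u v] | u : G].

(* The truncated subtraction is harmless: adjacent vertices have degree at
   least 1.  The value is +oo when G has no edge. *)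
Definition min_edge_degree : \bar int :=
  \big[mine/+oo%E]_(p : G * G | adj p.1 p.2) (deg p.1 + deg p.2 - 2)%N%:Z%:E.

Definition del_adj F : rel G := fun u v => adj u v && ([set u; v] \notin F).

Lemma del_adj_sym F : symmetric (del_adj F).
Proof. by move=> u v; rewrite /del_adj adj_sym setUC. Qed.

Lemma del_adj_irrefl F : irreflexive (del_adj F).
Proof. by move=> u; rewrite /del_adj adj_irrefl. Qed.

Definition del_edges F : sgraph := SGraph (del_adj_sym F) (del_adj_irrefl F).

End Graph.

Section RestrictedEdgeConnectivity.
Variable H : sgraph.
Implicit Type F : {set {set H}}.

Definition edge_cut F : bool :=
  (F \subset edges H) && ~~ connected (del_edges F).

Definition restricted_edge_cut F : bool :=
  edge_cut F && [forall C in components (del_edges F), 2 <= #|C|].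

Definition restricted_edge_connectivity : \bar int :=
  \big[mine/+oo%E]_(F : {set {set H}} | restricted_edge_cut F) #|F|%:Z%:E.

Definition min_restricted_edge_cut F : Prop :=
  restricted_edge_cut F /\
  forall F', restricted_edge_cut F' -> #|F| <= #|F'|.

Definition isolates_edge F : Prop :=
  exists u v : del_edges F,
    adj u v /\ [set u; v] \in components (del_edges F).

Definition super_restricted_edge_connected : Prop :=
  forall F, min_restricted_edge_cut F -> isolates_edge F.

End RestrictedEdgeConnectivity.

Section DirectProduct.
Variables G1 G2 : sgraph.

Definition prod_adj : rel (G1 * G2) := fun x y => adj x.1 y.1 && adj x.2 y.2.

Lemma prod_adj_sym : symmetric prod_adj.
Proof. by move=> x y; rewrite /prod_adj adj_sym [adj x.2 _]adj_sym. Qed.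

Lemma prod_adj_irrefl : irreflexive prod_adj.
Proof. by move=> x; rewrite /prod_adj adj_irrefl. Qed.

Definition direct_product : sgraph := SGraph prod_adj_sym prod_adj_irrefl.

End DirectProduct.

Section CompleteGraph.
Variable n : nat.

Definition complete_adj : rel 'I_n := fun i j => i != j.

Lemma complete_adj_sym : symmetric complete_adj.
Proof. by move=> i j; rewrite /complete_adj eq_sym. Qed.

Lemma complete_adj_irrefl : irreflexive complete_adj.
Proof. by move=> i; rewrite /complete_adj eqxx. Qed.

Definition complete_graph : sgraph := SGraph complete_adj_sym complete_adj_irrefl.

End CompleteGraph.

(* Main.v *)
Require Import Defs.
From mathcomp Require Import all_boot all_order all_algebra.
From mathcomp Require Import constructive_ereal.
From mathcomp Require Import zify.

(* Write a minimum restricted edge-cut of G x K_n as the boundary of a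
   2-colouring s (one component against the rest), and call the layer {u} x K_n
   mixed when it carries both colours.  The cost of an edge uv of G is the number
   of bichromatic pairs (i, j), i <> j, between the layers of u and v; twice the
   size of the cut is the sum of the costs over ordered edges.  An edge meeting a
   mixed layer costs at least n - 1, and one between two mixed layers at least
   2(n - 2), with equality only when the minority colour is a single vertex in
   each.  Isolating an edge above an edge of minimum edge-degree gives the upper
   bound (n - 1) xi(G) + 2(n - 2) for the cut.  If the cut isolates no edge, this
   bound is exceeded: when two mixed layers are adjacent, or when all neighbours
   of a constant layer use the other colour, by counting around one edge of G;
   otherwise every horizontal slice u |-> s (u, i) yields a restricted edge-cut of
   G and the cut has (n - 1) times their total size, at least
   n (n - 1) lambda'(G). *)

Set Implicit Arguments.
Unset Strict Implicit.
Unset Printing Implicit Defensive.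

(** * Edge-cuts as boundaries of 2-colourings *)

Lemma eq_set2 (T : finType) (a b c d : T) :
  [set a; b] = [set c; d] -> (a = c /\ b = d) \/ (a = d /\ b = c).
Proof.
move=> /setP eq_ab.
move: (eq_ab a) (eq_ab b) (eq_ab c) (eq_ab d).
rewrite !inE !eqxx ?orbT /= => /esym/orP ha /esym/orP hb hc hd.
case: ha hb hc hd => /eqP ->; case=> /eqP ->; rewrite ?orbb;
  by [left | right | move=> _ /eqP ->; left | move=> /eqP ->; left].
Qed.

Lemma deg_gt0 (G : sgraph) (u v : G) : adj u v -> 0 < deg u.
Proof. by move=> uv; rewrite card_gt0; apply/set0Pn; exists v; rewrite inE. Qed.

Section Cut.
Variables (H : sgraph) (s : pred H).

Definition cut : {set {set H}} :=
  [set [set p.1; p.2] | p : H * H & adj p.1 p.2 && (s p.1 != s p.2)].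

Lemma mem_cut x y : ([set x; y] \in cut) = adj x y && (s x != s y).
Proof.
apply/imsetP/idP => [[[a b]]|cut_xy]; last by exists (x, y); rewrite ?inE.
rewrite inE /= => cut_ab /eq_set2[] [-> ->] //.
by rewrite adj_sym eq_sym.
Qed.

Lemma del_adj_cut x y : del_adj cut x y = adj x y && (s x == s y).
Proof. by rewrite /del_adj mem_cut; case: (adj x y); rewrite //= negbK. Qed.

(** Each edge of the cut has exactly one orientation from colour [true] to colour [false], so [out]
    is in bijection with the cut; reversing it gives the other half of the ordered pairs. *)
Lemma card_cut : 2 * #|cut| = \sum_x \sum_y (adj x y && (s x != s y)).
Proof.
pose out := [set p : H * H | [&& adj p.1 p.2, s p.1 & ~~ s p.2]].
have -> : cut = [set [set p.1; p.2] | p in out].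
  apply/setP => e; apply/imsetP/imsetP => [] [[x y]]; rewrite inE /=.
    case/andP=> xy; case sx: (s x); case sy: (s y) => // _ ->.
      by exists (x, y); rewrite // inE /= xy sx sy.
    by exists (y, x); rewrite /= 1?setUC // inE /= adj_sym xy sx sy.
  by case/and3P=> xy sx sy ->; exists (x, y); rewrite // inE /= xy sx (negPf sy).
rewrite card_in_imset => [|[a b] [c d]]; last first.
  rewrite !inE /= => /and3P[_ sa sb] /and3P[_ sc sd].
  case/eq_set2=> [] [ac bd]; first by rewrite ac bd.
  by rewrite ac (negPf sd) in sa.
have card_out : #|out| = \sum_x \sum_y [&& adj x y, s x & ~~ s y].
  rewrite pair_big /= -sum1_card big_mkcond /=.
  by apply: eq_bigr => p _; rewrite inE; case: ifP.
have swap : \sum_x \sum_y [&& adj x y, s x & ~~ s y]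
          = \sum_x \sum_y [&& adj x y, ~~ s x & s y].
  rewrite exchange_big; apply: eq_bigr => y _; apply: eq_bigr => x _.
  by rewrite adj_sym [s x && _]andbC.
rewrite mul2n -addnn {2}card_out swap card_out -big_split; apply: eq_bigr => x _.
rewrite -big_split; apply: eq_bigr => y _ /=.
by case: (adj x y); case: (s x); case: (s y).
Qed.

Lemma connect_cut x y : connect (del_adj cut) x y -> s x = s y.
Proof.
have clo : closed (del_adj cut) s.
  by move=> a b; rewrite del_adj_cut => /andP[_ /eqP]; rewrite !unfold_in.
by move=> /(closed_connect clo); rewrite !unfold_in.
Qed.

Lemma restricted_edge_cut_cut :
  (exists x, s x) -> (exists x, ~~ s x) ->
  (forall x, exists2 y, adj x y & s x = s y) ->
  restricted_edge_cut cut.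
Proof.
move=> [x0 sx0] [y0 sy0] nonisolated.
apply/andP; split; [apply/andP; split|].
- apply/subsetP => e /imsetP[p]; rewrite inE => /andP[adj_p _] ->.
  by apply/imsetP; exists p; rewrite ?inE.
- apply/negP => /forallP/(_ x0)/forallP/(_ y0)/connect_cut.
  by rewrite sx0 (negPf sy0).
apply/forallP => C; apply/implyP => /imsetP[x _ ->].
have [y xy sxy] := nonisolated x.
apply: leq_trans (subset_leq_card (_ : [set x; y] \subset _)).
  by rewrite cards2; case: eqVneq xy => // <-; rewrite adj_irrefl.
apply/subsetP => z; rewrite !inE => /orP[] /eqP ->; first exact: connect0.
by apply: connect1; rewrite /= del_adj_cut xy sxy eqxx.
Qed.

End Cut.

(** Take [s] to be the component of [x0]. Its boundary lies in [F] and is itself a restricted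
    edge-cut, since [F] leaves every vertex a neighbour in its own component; minimality of [F]
    forces equality. *)
Lemma min_restricted_edge_cutE (H : sgraph) (F : {set {set H}}) :
  min_restricted_edge_cut F ->
  exists s : pred H, [/\ F = cut s, exists x, s x, exists x, ~~ s x
    & forall x, exists2 y, adj x y & s x = s y].
Proof.
move=> [/andP[/andP[_ /forallPn[x0 /forallPn[y0 ncon]]] /forallP comp2] minF].
have symF : connect_sym (del_adj F) by apply: sym_connect_sym; apply: del_adj_sym.
pose s : pred H := connect (del_adj F) x0.
have sub : cut s \subset F.
  apply/subsetP => e /imsetP[[x y]]; rewrite inE /= => /andP[xy sxy] ->.
  apply: contraNT sxy => nF; apply/eqP; apply: (same_connect_r symF).
  by apply: connect1; rewrite /del_adj xy.
have niso x : exists2 y, adj x y & s x = s y.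
  have := comp2 [set v | connect (del_adj F) x v].
  rewrite imset_f //= => comp_x.
  have [y xy] : exists y, del_adj F x y.
    apply/existsP; apply: contraTT comp_x => /existsPn isox.
    rewrite -leqNgt -(cards1 x); apply: subset_leq_card.
    apply/subsetP => z; rewrite !inE => /connectP[[|y p] /=]; first by move=> _ ->.
    by rewrite (negPf (isox y)).
  exists y; first by case/andP: xy.
  by apply: (same_connect_r symF); apply: connect1.
have ex1 : exists x, s x by exists x0; apply: connect0.
have ex2 : exists x, ~~ s x by exists y0.
exists s; split=> //; apply/esym/eqP.
by rewrite eqEcard sub minF // restricted_edge_cut_cut.
Qed.

Lemma isolates_edge_cut (H : sgraph) (s : pred H) x y :
  adj x y -> s x = s y ->
  (forall z, s z = s x -> adj x z || adj y z -> z \in [set x; y]) ->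
  isolates_edge (cut s).
Proof.
move=> xy sxy closed_xy; exists x, y; split.
  by rewrite /= del_adj_cut xy sxy eqxx.
apply/imsetP; exists x => //; apply/setP => z; rewrite inE.
apply/idP/idP => [|xz].
  rewrite !inE => /orP[] /eqP ->; first exact: connect0.
  by apply: connect1; rewrite /= del_adj_cut xy sxy eqxx.
have clo : closed (del_adj (cut s)) [set x; y].
  apply: (intro_closed (sym_connect_sym (@del_adj_sym _ _))) => a b.
  rewrite del_adj_cut => /andP[ab /eqP sab]; rewrite !inE => /orP[] /eqP aE; subst a.
    by have := closed_xy b; rewrite !inE; apply; rewrite ?sab ?ab.
  by have := closed_xy b; rewrite !inE; apply; rewrite ?sxy ?sab ?ab ?orbT.
by rewrite -(closed_connect clo xz) !inE eqxx.
Qed.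

(** * Counting bichromatic pairs between two layers *)

(** Here [a], [b] stand for the counts of one colour in two layers and [a'], [b'] for those of the
    other. With [n = a + b + d] the right-hand side becomes [a * a + b * b + d * (a + b)]. *)
Lemma bipartite_count_bound a b a' b' n : 5 <= n -> a + a' = n -> b + b' = n ->
  2 < a + b <= n -> 2 * (n - 2) + (a + b) < a * b' + a' * b.
Proof.
move=> n5 ea eb /andP[s3 sn].
have [d nE] : exists d, n = a + b + d by exists (n - (a + b)); lia.
have {ea} -> : a' = b + d by lia.
have {eb} -> : b' = a + d by lia.
have sq := nat_Cauchy a b; rewrite -!mulnn in sq.
have [t tE] : exists t, a + b = t + 3 by exists (a + b - 3); lia.
have tt : (a + b) * (a + b) = (t + 3) * (t + 3) by rewrite tE.
have dE : a * (a + d) + (b + d) * b = a * a + b * b + d * (t + 3).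
  by rewrite -tE; lia.
rewrite dE nE tE.
(* For [a + b] equal to 3 or 4 the terms free of [d] can tie, and [n5] gives strictness by making
   [d] positive; from 5 on the squares alone are large enough. *)
have [t0|[t1|t2]] : t = 0 \/ t = 1 \/ 2 <= t by lia.
- subst t; nia.
- subst t; nia.
nia.
Qed.

Section Cost.
Variable n : nat.
Implicit Types (A B : pred 'I_n) (e : bool).

Definition cost A B := \sum_(i < n) \sum_(j < n) ((i != j) && (A i != B j)).

Definition count_colour A e := \sum_(i < n) (A i == e).

Definition mixed A := [exists i, exists j, A i != A j].

Lemma costC A B : cost A B = cost B A.
Proof.
rewrite /cost exchange_big; apply: eq_bigr => i _; apply: eq_bigr => j _.
by rewrite eq_sym [A _ == _]eq_sym.
Qed.

Lemma count_colourC A e : count_colour A e + count_colour A (~~ e) = n.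
Proof.
rewrite -big_split /= -[RHS]card_ord -sum1_card; apply: eq_bigr => i _.
by case: (A i) e => [] [].
Qed.

Lemma count_colour_gt0 A e i : A i = e -> 0 < count_colour A e.
Proof. by move=> Ai; rewrite /count_colour (bigD1 i) // Ai eqxx. Qed.

Lemma exists_colour A e : 0 < count_colour A e -> exists i, A i = e.
Proof.
rewrite lt0n sum_nat_eq0 => /forallPn[i]; rewrite eqb0 negbK => /eqP Ai.
by exists i.
Qed.

Lemma mixed_count_gt0 A e : mixed A -> 0 < count_colour A e.
Proof.
case/existsP=> i /existsP[j]; have [Ai|] := eqVneq (A i) e.
  by move=> _; apply: count_colour_gt0 Ai.
move=> Ai Aij; apply: (@count_colour_gt0 _ _ j).
by move: Ai Aij; case: (A i) (A j) e => [] [] [].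
Qed.

Lemma non_mixed A i j : ~~ mixed A -> A i = A j.
Proof. by move=> /existsPn/(_ i)/existsPn/(_ j); rewrite negbK => /eqP. Qed.

Lemma mixedI A i j : A i != A j -> mixed A.
Proof. by move=> Aij; apply/existsP; exists i; apply/existsP; exists j. Qed.

(** The two products count all bichromatic pairs, including those with [i = j]. The number of these
    diagonal pairs is the sum of the two counts of [e] minus twice the number of common positions;
    terms are moved across to avoid subtraction. *)
Lemma cost_count A B e :
  cost A B + count_colour A e + count_colour B e =
  count_colour A e * count_colour B (~~ e)
  + count_colour A (~~ e) * count_colour B e
  + 2 * \sum_(i < n) ((A i == e) && (B i == e)).
Proof.
have -> : count_colour A e * count_colour B (~~ e)
    + count_colour A (~~ e) * count_colour B e
    = cost A B + \sum_(i < n) (A i != B i).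
  rewrite /count_colour !big_distrl -!big_split /=; apply: eq_bigr => i _.
  rewrite !big_distrr -big_split (bigD1 i) //= [RHS]addnC.
  rewrite [X in _ = _ + X](bigD1 i) //= eqxx add0n; congr addn.
    by case: (A i) (B i) e => [] [] [].
  apply: eq_bigr => j; rewrite eq_sym => -> /=.
  by case: (A i) (B j) e => [] [] [].
rewrite -!addnA; congr addn; rewrite big_distrr -!big_split /=.
by apply: eq_bigr => i _; case: (A i) (B i) e => [] [] [].
Qed.

Lemma cost_const A B e :
  (forall i, A i = e) -> cost A B = (n - 1) * count_colour B (~~ e).
Proof.
move=> Ae; have := cost_count A B e.
have -> : \sum_(i < n) ((A i == e) && (B i == e)) = count_colour B e.
  by apply: eq_bigr => i _; rewrite Ae eqxx.
have <- : n = count_colour A e.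
  rewrite -[LHS]card_ord -sum1_card; apply: eq_bigr => i _.
  by rewrite Ae eqxx.
have -> : count_colour A (~~ e) = 0.
  by apply: big1 => i _; rewrite Ae; case: (e).
have := count_colourC B e; nia.
Qed.

Lemma count_colour_eq1 A e :
  count_colour A e = 1 -> exists i, forall k, (A k == e) = (k == i).
Proof.
move=> A1; have [i Ai] : exists i, A i = e by apply: exists_colour; rewrite A1.
exists i => k; have [->|ki] := eqVneq k i; first by rewrite Ai eqxx.
apply: contra_eqF A1 => /eqP Ak.
by rewrite /count_colour (bigD1 i) // (bigD1 k) // Ai Ak eqxx.
Qed.

Hypothesis n_ge5 : 5 <= n.

Lemma cost_mixed2 A B : mixed A -> mixed B ->
  2 * (n - 2) < cost A B \/
  2 * (n - 2) <= cost A B /\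
  exists e, count_colour A e = 1 /\ count_colour B e = 1.
Proof.
move=> mA mB.
(* The two colours together occur 2n times in the two layers, so one of them occurs at most n
   times. *)
have [e le_n] : exists e, count_colour A e + count_colour B e <= n.
  have [le_n|lt_n] := leqP (count_colour A true + count_colour B true) n.
    by exists true.
  exists false; have := count_colourC A true; have := count_colourC B true.
  rewrite /=; lia.
have costE := cost_count A B e.
have a0 := mixed_count_gt0 e mA; have b0 := mixed_count_gt0 e mB.
have [ab2|ab_gt2] : count_colour A e + count_colour B e <= 2 \/
                    2 < count_colour A e + count_colour B e by lia.
  have a1 : count_colour A e = 1 by lia.
  have b1 : count_colour B e = 1 by lia.
  right; split; last by exists e.
  have := count_colourC A e; have := count_colourC B e; nia.
left; have := bipartite_count_bound n_ge5 (count_colourC A e) (count_colourC B e).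
rewrite ab_gt2 le_n => /(_ isT); lia.
Qed.

Lemma cost_mixed A B : mixed A -> n - 1 <= cost A B.
Proof.
move=> mA; have [mB|nmB] := boolP (mixed B).
  by case: (cost_mixed2 mA mB) => [|[]]; lia.
have n_gt0 : 0 < n by lia.
rewrite costC (@cost_const B A (B (Ordinal n_gt0))) => [|i]; last exact: non_mixed.
by rewrite leq_pmulr // mixed_count_gt0.
Qed.

(** Improves the bound of [cost_mixed] by one, which yields strictness in [mixed_adj_total]; [B] may
    be constant of colour [e]. *)
Lemma cost_single A B e :
  count_colour A e = 1 -> 0 < count_colour B e -> n <= cost A B.
Proof.
move=> A1 B0; have := cost_count A B e; rewrite A1.
have := count_colourC A e; have := count_colourC B e; rewrite A1.
nia.
Qed.

End Cost.

(** * Summation around an edge *)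

(** Rows and columns [u] and [v] of the symmetric matrix [f] overlap, apart from zero diagonal
    cells, only in the cells (u, v) and (v, u), which are counted twice. *)
Lemma sum_two_rows (T : finType) (f : T -> T -> nat) u v :
  (forall x y, f x y = f y x) -> f u u = 0 -> f v v = 0 -> u != v ->
  2 * (\sum_y f u y + \sum_y f v y) <= \sum_x \sum_y f x y + 2 * f u v.
Proof.
move=> symf fuu fvv uv.
have rest : \sum_(x | (x != u) && (x != v)) (f x u + f x v)
            <= \sum_(x | (x != u) && (x != v)) \sum_y f x y.
  apply: leq_sum => x _; rewrite (bigD1 u) //= leq_add2l (bigD1 v) 1?eq_sym //=.
  exact: leq_addr.
rewrite big_split /= in rest.
have vu : v != u by rewrite eq_sym.
have row_u : \sum_y f u y = f u v + \sum_(x | (x != u) && (x != v)) f x u.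
  rewrite (bigD1 u) // (bigD1 v) //= fuu add0n; congr addn.
  exact: eq_bigr.
have row_v : \sum_y f v y = f u v + \sum_(x | (x != u) && (x != v)) f x v.
  rewrite (bigD1 u) // (bigD1 v) //= fvv add0n symf; congr addn.
  exact: eq_bigr.
rewrite [X in _ <= X + _](bigD1 u) // [X in _ <= _ + X + _](bigD1 v) //=; lia.
Qed.

Lemma leq_sum_one (T : finType) (P : {set T}) (f : T -> nat) k v :
  v \in P -> (forall w, w \in P -> k <= f w) ->
  k * (#|P| - 1) + f v <= \sum_(w in P) f w.
Proof.
move=> Pv kf; rewrite (big_setD1 v) //= addnC leq_add2l (cardsD1 v) Pv addKn.
rewrite mulnC -sum_nat_const; apply: leq_sum => w.
by rewrite !inE => /andP[_ /kf].
Qed.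

Lemma leq_sum_two (T : finType) (P : {set T}) (f : T -> nat) k v v' :
  v \in P -> v' \in P -> v' != v -> (forall w, w \in P -> k <= f w) ->
  k * (#|P| - 2) + f v + f v' <= \sum_(w in P) f w.
Proof.
move=> Pv Pv' vv' kf; rewrite (big_setD1 v) //=.
have := @leq_sum_one _ (P :\ v) f k v'; rewrite !inE vv' Pv' (cardsD1 v P) Pv.
move=> /(_ isT); set S := \sum_(w in _) _ => le_S.
suff : k * (#|P :\ v| - 1) + f v' <= S.
  by rewrite (_ : 1 + #|P :\ v| - 2 = #|P :\ v| - 1); lia.
by apply: le_S => w; rewrite !inE => /andP[_ /kf].
Qed.

(** * Lower bounds for the cost of a colouring of the layers *)

Section Layers.
Variables (G : sgraph) (n : nat) (s : G -> pred 'I_n).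
Hypothesis n_ge5 : 5 <= n.

Let total := \sum_u \sum_v adj u v * cost (s u) (s v).

(** The edges meeting [u] or [v], other than [uv], number [deg u + deg v - 2] and each costs at
    least n - 1. The bound is therefore exceeded once [uv] costs more than 2(n - 2), or once [uv]
    and one further edge [uw] do so jointly with n - 1 added. *)
Lemma cost_edge_excess u v :
  adj u v ->
  (forall w, adj u w -> n - 1 <= cost (s u) (s w)) ->
  (forall w, adj v w -> n - 1 <= cost (s v) (s w)) ->
  2 * (n - 2) < cost (s u) (s v) \/
  (exists w, [/\ adj u w, w != v &
     2 * (n - 2) + (n - 1) < cost (s u) (s v) + cost (s u) (s w)]) ->
  2 * ((n - 1) * (deg u + deg v - 2) + 2 * (n - 2)) < total.
Proof.
move=> uv cost_u cost_v excess.
pose f x y := adj x y * cost (s x) (s y).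
have rowE x : \sum_y f x y = \sum_(y in [set y | adj x y]) cost (s x) (s y).
  rewrite [RHS]big_mkcond /=; apply: eq_bigr => y _; rewrite inE /f.
  by case: (adj x y); rewrite ?mul1n.
have := @sum_two_rows _ f u v; rewrite !rowE /f uv mul1n -/total.
have du := deg_gt0 uv.
have dv : 0 < deg v by apply: (@deg_gt0 _ _ u); rewrite adj_sym.
have row_v : (n - 1) * (deg v - 1) + cost (s u) (s v) <=
             \sum_(y in [set y | adj v y]) cost (s v) (s y).
  rewrite costC; apply: leq_sum_one; first by rewrite inE adj_sym.
  by move=> w; rewrite inE; apply: cost_v.
have neq_uv : u != v by apply: contraTneq uv => ->; rewrite adj_irrefl.
move=> /(_ _ _ _ neq_uv) rows.
have {}rows : 2 * (\sum_(y in [set y | adj u y]) cost (s u) (s y) +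
   \sum_(y in [set y | adj v y]) cost (s v) (s y)) <= total + 2 * cost (s u) (s v).
  by apply: rows; rewrite ?adj_irrefl // => x y; rewrite adj_sym costC.
case: excess => [excess|[w [uw wv excess]]].
  have row_u : (n - 1) * (deg u - 1) + cost (s u) (s v) <=
               \sum_(y in [set y | adj u y]) cost (s u) (s y).
    by apply: leq_sum_one => [|w]; rewrite inE //; apply: cost_u.
  nia.
(* Two distinct neighbours make [deg u - 2] below a genuine subtraction. *)
have du2 : 1 < deg u.
  have <- : #|[set v; w]| = 2 by rewrite cards2 eq_sym wv.
  apply: subset_leq_card.
  by apply/subsetP => z; rewrite !inE => /orP[] /eqP ->.
have row_u : (n - 1) * (deg u - 2) + cost (s u) (s v) + cost (s u) (s w) <=
             \sum_(y in [set y | adj u y]) cost (s u) (s y).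
  by apply: leq_sum_two => [|||z]; rewrite ?inE //; apply: cost_u.
nia.
Qed.

(** No vertex of the product is isolated after the cut is removed. *)
Hypothesis mono_neighbour :
  forall u i, exists v j, [/\ adj u v, i != j & s u i = s v j].

(** No monochromatic edge of the product is a component by itself: the cut isolates no edge. *)
Hypothesis mono_edge_extends : forall u i v j,
  adj u v -> i != j -> s u i = s v j ->
  exists w k, [/\ (w, k) \notin [set (u, i); (v, j)], s w k = s u i &
                  (adj u w && (i != k)) || (adj v w && (j != k))].

(** In the tight case of [cost_mixed2] the minority colour [e] occurs once in each layer, at [i] and
    [j]. If [i = j], the common position adds 2 to the cost. Otherwise (u, i)(v, j) is a
    monochromatic edge, and extending it reaches a third layer [w] containing [e], so [uw] or [vw]
    costs at least n. *)
Lemma mixed_adj_total u v : adj u v -> mixed (s u) -> mixed (s v) ->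
  2 * ((n - 1) * (deg u + deg v - 2) + 2 * (n - 2)) < total.
Proof.
move=> uv mu mv.
have n1E : (n - 1).+1 = n by rewrite subn1 prednK // (leq_trans _ n_ge5).
have cost_u w : adj u w -> n - 1 <= cost (s u) (s w) by move=> _; apply: cost_mixed.
have cost_v w : adj v w -> n - 1 <= cost (s v) (s w) by move=> _; apply: cost_mixed.
have [big_cost|[small_cost [e [u1 v1]]]] := cost_mixed2 n_ge5 mu mv.
  by apply: cost_edge_excess => //; left.
have [i ui] := count_colour_eq1 u1; have [j vj] := count_colour_eq1 v1.
have sui : s u i = e by apply/eqP; rewrite ui.
have svj : s v j = e by apply/eqP; rewrite vj.
have [ij|neq_ij] := eqVneq i j.
  apply: cost_edge_excess => //; left.
  have := cost_count (s u) (s v) e; rewrite u1 v1.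
  have := count_colourC (s u) e; have := count_colourC (s v) e; rewrite u1 v1.
  rewrite (bigD1 i) //= ui vj -ij eqxx; nia.
have [|w [k [wk swk]]] := @mono_edge_extends u i v j uv neq_ij.
  by rewrite sui svj.
rewrite sui in swk.
have w_pos := count_colour_gt0 swk.
rewrite !inE !xpair_eqE negb_or in wk; case/andP: wk => wu wv.
case/orP=> /andP[adj_w _].
  apply: cost_edge_excess => //; right; exists w; split=> //.
    by apply: contraNneq wv => wE; subst w; rewrite eqxx -vj swk eqxx.
  by rewrite -addnS n1E leq_add // (cost_single n_ge5 u1 w_pos).
(* Here [w] is adjacent to [v], so the roles of [u] and [v] are exchanged. *)
rewrite [deg u + _]addnC; apply: (cost_edge_excess (v := u)) => //; rewrite 1?adj_sym //.
right; exists w; split=> //.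
  by apply: contraNneq wu => wE; subst w; rewrite eqxx -ui swk eqxx.
by rewrite costC -addnS n1E leq_add // (cost_single n_ge5 v1 w_pos).
Qed.

Hypothesis mixed_indep : forall u v, adj u v -> mixed (s u) -> ~~ mixed (s v).

(** A monochromatic neighbour of the layer of [v] lies in a layer [u] that must be mixed, and [uv]
    costs n - 1 times the count of the other colour in [u]. Two such vertices suffice. A single one
    has a neighbour of its own colour in a layer [w], constant by [mixed_indep], and then [uw] costs
    (n - 1)^2. *)
Lemma const_layer_total v e :
  (forall i, s v i = e) -> (forall w, adj v w -> exists i, s w i != e) ->
  exists2 u, adj u v & 2 * ((n - 1) * (deg u + deg v - 2) + 2 * (n - 2)) < total.
Proof.
move=> sv sv_neighbour.
have n_gt0 : 0 < n by lia.
have [u [k [vu _ sk]]] := mono_neighbour v (Ordinal n_gt0).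
have uv : adj u v by rewrite adj_sym.
rewrite sv in sk; exists u => //.
have [k' sk'] := sv_neighbour u vu.
have mu : mixed (s u) by apply: (@mixedI _ _ k' k); rewrite -sk.
have cost_u w : adj u w -> n - 1 <= cost (s u) (s w) by move=> _; apply: cost_mixed.
have cost_v w : adj v w -> n - 1 <= cost (s v) (s w).
  move=> /sv_neighbour[i swi]; rewrite (cost_const _ sv) leq_pmulr //.
  by apply: (@count_colour_gt0 _ _ _ i); move: swi; clear; case: (s w i) e => [] [].
apply: cost_edge_excess => //.
rewrite costC (cost_const _ sv).
have := mixed_count_gt0 (~~ e) mu.
have [eq1|neq1] := eqVneq (count_colour (s u) (~~ e)) 1; last first.
  by move=> pos; left; nia.
right.
have [w [l [uw _ sl]]] := mono_neighbour u k'.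
have sul : s w l = ~~ e by rewrite -sl; move: sk'; clear; case: (s u k') e => [] [].
have sw i : s w i = ~~ e by rewrite -sul; apply: non_mixed; apply: mixed_indep uw mu.
exists w; split=> //.
  by apply/eqP => wE; move: (sv l); rewrite -wE sul; case: (e).
rewrite costC (cost_const _ sw) negbK.
have := count_colourC (s u) e.
nia.
Qed.

Lemma slices_total :
  total = (n - 1) * \sum_(i < n) 2 * #|cut (fun u => s u i)|.
Proof.
have costE u v : adj u v ->
    cost (s u) (s v) = (n - 1) * \sum_(i < n) (s u i != s v i).
  have n_gt0 : 0 < n by lia.
  pose i0 := Ordinal n_gt0.
  (* At most one end of an edge is mixed and the cost is symmetric. *)
  wlog nmu : u v / ~~ mixed (s u) => [ih uv|uv].
    have [mu|] := boolP (mixed (s u)); last by move=> nmu; apply: ih.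
    rewrite costC ih 1?adj_sym ?(mixed_indep uv mu) //; congr muln.
    by apply: eq_bigr => i _; rewrite eq_sym.
  have su i : s u i = s u i0 by apply: non_mixed.
  rewrite (cost_const _ su); congr muln; apply: eq_bigr => i _.
  by rewrite su; case: (s v i) (s u i0) => [] [].
under [in RHS]eq_bigr do rewrite card_cut.
rewrite exchange_big big_distrr /=; apply: eq_bigr => u _.
rewrite exchange_big big_distrr /=; apply: eq_bigr => v _.
case uv: (adj u v); last by rewrite mul0n big1 ?muln0.
by rewrite mul1n costE.
Qed.

End Layers.

(** * Combining the local bounds with the slice argument *)

Lemma total_gt (G : sgraph) (n : nat) (s : G -> pred 'I_n) (xi : nat) :
  5 <= n ->
  (forall u i, exists v j, [/\ adj u v, i != j & s u i = s v j]) ->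
  (forall u i v j, adj u v -> i != j -> s u i = s v j ->
     exists w k, [/\ (w, k) \notin [set (u, i); (v, j)], s w k = s u i &
                     (adj u w && (i != k)) || (adj v w && (j != k))]) ->
  (forall e, exists u i, s u i = e) ->
  (forall u v : G, adj u v -> xi <= deg u + deg v - 2) ->
  (forall F : {set {set G}}, restricted_edge_cut F ->
     (n - 1) * xi + 2 * (n - 2) < n * (n - 1) * #|F|) ->
  2 * ((n - 1) * xi + 2 * (n - 2))
  < \sum_u \sum_v adj u v * cost (s u) (s v).
Proof.
move=> n_ge5 mono_neighbour mono_edge_extends both_colours xi_min lambda_gt.
have from_edge (u v : G) : adj u v ->
    2 * ((n - 1) * xi + 2 * (n - 2)) <=
    2 * ((n - 1) * (deg u + deg v - 2) + 2 * (n - 2)).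
  by move=> /xi_min le_xi; rewrite leq_mul2l leq_add2r leq_mul2l le_xi orbT.
have [/existsP[u /existsP[v /and3P[uv mu mv]]]|/existsPn no_mixed_edge] :=
    boolP [exists u, exists v, [&& adj u v, mixed (s u) & mixed (s v)]].
  by apply: leq_ltn_trans (from_edge _ _ uv) _; apply: mixed_adj_total.
have mixed_indep u v : adj u v -> mixed (s u) -> ~~ mixed (s v).
  move=> uv mu; apply: contra (no_mixed_edge u) => mv.
  by apply/existsP; exists v; rewrite uv mu mv.
have [/existsP[v /existsP[e /andP[/forallP sv /forallP nb_v]]]|/existsPn] :=
    boolP [exists v, exists e, [forall i, s v i == e] &&
             [forall w, adj v w ==> [exists i, s w i != e]]].
  have [||u uv lt_total] := @const_layer_total _ _ s n_ge5 mono_neighbour mixed_indep v e.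
  - by move=> i; apply/eqP.
  - by move=> w vw; apply/existsP; move/implyP: (nb_v w); apply.
  exact: leq_ltn_trans (from_edge _ _ uv) lt_total.
move=> const_nb.
have const_neighbour v e : (forall i, s v i = e) ->
    exists2 w, adj v w & forall i, s w i = e.
  move=> sv; have /existsPn/(_ e) := const_nb v.
  rewrite negb_and => /orP[/forallPn[i]|]; first by rewrite sv eqxx.
  case/forallPn=> w; rewrite negb_imply => /andP[vw /existsPn sw].
  by exists w => // i; apply/eqP; rewrite -[_ == _]negbK.
(* A monochromatic neighbour of a vertex in a mixed layer lies in a constant layer, so its index can
   be changed to [i]; a constant layer has an adjacent constant layer of the same colour. *)
have slice_neighbour i u : exists2 v, adj u v & s u i = s v i.
  have [mu|nmu] := boolP (mixed (s u)).
    have [v [j [uv _ ->]]] := mono_neighbour u i.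
    by exists v => //; apply/non_mixed/(mixed_indep u).
  have [|v uv sv] := @const_neighbour u (s u i); first by move=> j; apply: non_mixed.
  by exists v; rewrite ?sv.
have slice_colour i e : exists u, s u i = e.
  have [u [j suj]] := both_colours e.
  have [mu|nmu] := boolP (mixed (s u)).
    have [v [k [uv _ svk]]] := mono_neighbour u j.
    by exists v; rewrite -suj svk; apply/non_mixed/(mixed_indep u).
  by exists u; rewrite -suj; apply: non_mixed.
have slice_gt i :
    (n - 1) * xi + 2 * (n - 2) < n * (n - 1) * #|cut (fun u => s u i)|.
  apply/lambda_gt/restricted_edge_cut_cut; last exact: slice_neighbour.
    exact: slice_colour i true.
  by have [u su] := slice_colour i false; exists u; rewrite su.
rewrite slices_total // -big_distrr /= mulnCA ltn_mul2l /=.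
(* The n strict slice bounds are added and the common factor n is cancelled. *)
have : \sum_(i < n) ((n - 1) * xi + 2 * (n - 2)).+1 <=
       \sum_(i < n) n * (n - 1) * #|cut (fun u => s u i)|.
  by apply: leq_sum => i _; apply: slice_gt.
rewrite sum_nat_const card_ord -big_distrr /= -mulnA leq_mul2l.
by case: eqP => // n0; lia.
Qed.

(** * Cuts and degrees in the direct product, and the upper bound *)

Section Product.
Variables (G : sgraph) (n : nat).
Local Notation H := (direct_product G (complete_graph n)).

Lemma card_cut_product (s : pred H) :
  2 * #|cut s| =
  \sum_u \sum_v adj u v * cost (fun i => s (u, i)) (fun i => s (v, i)).
Proof.
have sumE (f : H -> nat) : \sum_x f x = \sum_(u : G) \sum_(i < n) f (u, i).
  by rewrite pair_bigA; apply: eq_bigr => -[].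
rewrite card_cut sumE; apply: eq_bigr => u _.
have -> := eq_bigr _ (fun (i : 'I_n) (_ : true) =>
  sumE (fun y => adj ((u, i) : H) y && (s (u, i) != s y))).
rewrite exchange_big; apply: eq_bigr => v _ /=.
rewrite /cost big_distrr; apply: eq_bigr => i _ /=.
rewrite big_distrr; apply: eq_bigr => j _ /=.
by rewrite /prod_adj /= /complete_adj mulnb andbA.
Qed.

Lemma deg_product (u : G) (i : 'I_n) : deg ((u, i) : H) = deg u * (n - 1).
Proof.
rewrite /deg subn1 -[X in _ * X.-1](card_ord n) -(cardsC1 i) -cardsX.
apply: eq_card => -[v j]; rewrite !inE /= /prod_adj /= /complete_adj.
by rewrite eq_sym.
Qed.

End Product.

(** The boundary is covered by the stars at [x] and at [y], each without the edge [xy]. *)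
Lemma card_cut_pred2 (H : sgraph) (x y : H) :
  adj x y -> #|cut (pred2 x y)| <= deg x + deg y - 2.
Proof.
move=> xy; have dx := deg_gt0 xy.
have dy : 0 < deg y by apply: (@deg_gt0 _ _ x); rewrite adj_sym.
pose star a b := [set [set a; z] | z in [set z : H | adj a z] :\ b].
have card_star a b : adj a b -> #|star a b| <= deg a - 1.
  move=> ab; apply: leq_trans (leq_imset_card _ _) _.
  by rewrite /deg (cardsD1 b [set v | adj a v]) inE ab addKn.
have cut_sub : cut (pred2 x y) \subset star x y :|: star y x.
  apply/subsetP => e /imsetP[[a b]]; rewrite inE /= => /andP[ab sab] ->.
  wlog: a b ab sab / (a == x) || (a == y).
    move=> ih; have [|na] := boolP ((a == x) || (a == y)); first exact: ih.
    rewrite setUC; apply: ih; [by rewrite adj_sym | by rewrite eq_sym |].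
    by move: sab; rewrite /= (negPf na); case: (_ || _).
  move=> aE; move: sab; rewrite aE negb_or => /andP[bx by_].
  rewrite inE; case/orP: aE => /eqP aE; subst a; apply/orP; [left | right].
    by apply/imsetP; exists b; rewrite // !inE by_ ab.
  by apply/imsetP; exists b; rewrite // !inE bx ab.
apply: leq_trans (subset_leq_card cut_sub) _.
apply: leq_trans (leq_card_setU _ _) _.
have yx : adj y x by rewrite adj_sym.
apply: leq_trans (leq_add (card_star x y xy) (card_star y x yx)) _.
by rewrite addnBA // addnBAC // -subnDA.
Qed.

Lemma connected_neighbour (G : sgraph) (u : G) :
  2 <= #|G| -> connected G -> exists v, adj u v.
Proof.
move=> G_nontrivial /forallP/(_ u)/forallP conn_u.
have [w wu] : exists w, w != u.
  apply/existsP; apply: contraTT G_nontrivial => /existsPn all_u.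
  rewrite -leqNgt -(card1 u); apply: subset_leq_card; apply/subsetP => w _.
  by rewrite inE -[_ == _]negbK.
have /connectP[[|v p] /=] := conn_u w; first by move=> _ wE; rewrite wE eqxx in wu.
by move=> /andP[uv _] _; exists v.
Qed.

(** The cut isolates the edge (u, 0)(v, 1), whose edge-degree in the product is (n - 1)(deg u + deg
    v) - 2, which is the stated bound. *)
Lemma restricted_edge_cut_edge (G : sgraph) (n : nat) (u v : G) :
  2 <= #|G| -> connected G -> 5 <= n -> adj u v ->
  exists2 F : {set {set direct_product G (complete_graph n)}},
    restricted_edge_cut F & #|F| <= (n - 1) * (deg u + deg v - 2) + 2 * (n - 2).
Proof.
move=> G_nontrivial G_connected n_ge5 uv.
have lt_n k : k < 5 -> k < n by move=> lt_k; apply: leq_trans n_ge5.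
pose o k (lt_k : k < 5) := Ordinal (lt_n k lt_k).
pose x : direct_product G (complete_graph n) := (u, o 0 isT).
pose y : direct_product G (complete_graph n) := (v, o 1 isT).
have xy : adj x y by rewrite /= /prod_adj /= uv.
have du := deg_gt0 uv.
have dv : 0 < deg v by apply: (@deg_gt0 _ _ u); rewrite adj_sym.
exists (cut (pred2 x y)); last first.
  apply: leq_trans (card_cut_pred2 xy) _; rewrite !deg_product; nia.
apply: restricted_edge_cut_cut.
- by exists x; rewrite /= eqxx.
- by exists (u, o 2 isT); rewrite /= !xpair_eqE /= !andbF.
move=> [w k]; have [zxy|nzxy] := boolP (pred2 x y (w, k)).
  case/orP: (zxy) => /eqP zE; [exists y|exists x]; rewrite ?zE //.
  - by rewrite /= !eqxx ?orbT.
  - by rewrite adj_sym.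
  by rewrite /= !eqxx ?orbT.
have [w' ww'] := connected_neighbour w G_nontrivial G_connected.
(* An index above 1 keeps (w', l) away from both [x] and [y]; 2 or 3 differs from [k]. *)
have [l kl l_gt1] : exists2 l : 'I_n, k != l & 1 < l.
  have [k2|k2] := eqVneq k (o 2 isT); [exists (o 3 isT) | exists (o 2 isT)] => //.
  by rewrite k2.
exists (w', l); first by rewrite /= /prod_adj /= ww'.
apply/esym/negbTE.
rewrite /= !xpair_eqE negb_or !negb_and -!val_eqE /=.
by case: (val l) l_gt1 => [|[|m]] // _; rewrite !orbT.
Qed.

(** * Passing from extended integers to natural numbers *)

Section LambdaBound.
Import Order.TTheory GRing.Theory Num.Theory.
Local Open Scope ring_scope.

(** Since [G] has an edge, the minimum edge-degree is finite and attained. If the restricted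
    edge-connectivity is infinite there is no [F], and the last clause holds vacuously. *)
Lemma lambda_bound_nat (G : sgraph) (n : nat) (u0 v0 : G) :
  adj u0 v0 ->
  ((n - 1)%N%:Z%:E * min_edge_degree G + (2 * (n - 2))%N%:Z%:E
   < (n * (n - 1))%N%:Z%:E * restricted_edge_connectivity G)%E ->
  exists u v : G, [/\ adj u v,
    forall x y : G, adj x y -> (deg u + deg v - 2 <= deg x + deg y - 2)%N &
    forall F : {set {set G}}, restricted_edge_cut F ->
     ((n - 1) * (deg u + deg v - 2) + 2 * (n - 2) < n * (n - 1) * #|F|)%N].
Proof.
move=> uv0.
pose edge (p : G * G) := adj p.1 p.2.
pose xi (p : G * G) : \bar int := (deg p.1 + deg p.2 - 2)%N%:Z%:E.
(* The default [+oo] of the minimum must lie above all its terms for the minimum to be attained at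
   an edge. *)
have le_infty p : edge p -> (xi p <= +oo%E)%O by rewrite leey.
have [[u v] /= uv xiE] := eq_bigmin (u0, v0) edge xi uv0 le_infty.
rewrite /min_edge_degree xiE => bound; exists u, v; split=> // [x y xy|F resF].
  have : (\big[Order.min/(+oo%E : \bar int)]_(p | edge p) xi p <= xi (x, y))%O.
    exact: bigmin_le_cond.
  by rewrite xiE lee_fin lez_nat.
have le_F : (restricted_edge_connectivity G <= #|F|%:Z%:E)%E.
  exact: bigmin_le_cond.
have : ((n * (n - 1))%N%:Z%:E * restricted_edge_connectivity G
        <= (n * (n - 1))%N%:Z%:E * #|F|%:Z%:E)%E.
  by apply: lee_wpmul2l => //; rewrite lee_fin.
move=> /(lt_le_trans bound).
by rewrite -!EFinM -EFinD lte_fin -!PoszM -PoszD ltz_nat.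
Qed.

End LambdaBound.

Theorem theorem3p1 (G : sgraph) (n : nat)
    (G_nontrivial : 2 <= #|G|) (G_connected : connected G) (n_ge5 : 5 <= n)
    (lambda_bound :
       ((n - 1)%N%:Z%:E * min_edge_degree G + (2 * (n - 2))%N%:Z%:E
        < (n * (n - 1))%N%:Z%:E * restricted_edge_connectivity G)%E) :
  super_restricted_edge_connected (direct_product G (complete_graph n)).
Proof.
have [u0 [v0 uv0]] : exists u v : G, adj u v.
  have [u _] : exists u : G, true.
    by have /card_gt0P[u _] : 0 < #|G|; [lia | exists u].
  by exists u; apply: connected_neighbour.
have [u [v [uv xi_min lambda_gt]]] := lambda_bound_nat uv0 lambda_bound.
move=> F minF.
have [s [FE [x1 sx1] [x0 sx0] mono]] := min_restricted_edge_cutE minF.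
have [F' resF' cardF'] :=
  restricted_edge_cut_edge G_nontrivial G_connected n_ge5 uv.
(* The upper bound becomes the negation of the strict lower bound, to be refuted when no edge is
   isolated. *)
have := leq_trans (minF.2 F' resF') cardF'; rewrite FE leqNgt.
(* Either some monochromatic edge has no further neighbour of its colour, and is isolated, or every
   such edge extends as [total_gt] requires. *)
have [/existsP[x /existsP[y /and3P[xy /eqP sxy /forallP closed_xy]]]|] := boolP
    [exists x, exists y, [&& adj x y, s x == s y &
      [forall z, (s z == s x) && (adj x z || adj y z) ==> (z \in [set x; y])]]].
  move=> _; apply: isolates_edge_cut xy sxy _ => z szx adj_z.
  by apply: (implyP (closed_xy z)); rewrite szx eqxx.
move=> /existsPn no_isolated_edge; case/negP.
rewrite -(ltn_pmul2l (isT : 0 < 2)) card_cut_product.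
apply: total_gt => //.
- move=> a i; have [[b j] /andP[ab ij] sab] := mono (a, i).
  by exists b, j.
- move=> a i b j ab ij sab.
  have /existsPn/(_ (b, j)) := no_isolated_edge (a, i).
  rewrite [adj _ _]/= /prod_adj /= ab /complete_adj ij sab eqxx /=.
  case/forallPn=> -[w k]; rewrite negb_imply => /andP[/andP[/eqP swk adj_wk] nin].
  by exists w, k.
- move=> [].
    by case: x1 sx1 => a i sx1; exists a, i.
  by case: x0 sx0 => a i /negbTE sx0; exists a, i.
Qed.
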